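(* Let $F:[0,\infty)\to[0,\infty)$, $F\in C^1([0,\infty))\cap C^2((0,\infty))$, be a strictly convex function such that $F(0)=0$ and $F'(s)=C\,s^\alpha+o(s^\alpha)$ as $s\to0^+$ for some positive constants $C$ and $\alpha$. Set $\Lambda(s)=s\,F''(s)/F'(s)$ for $s>0$ and assume that, for some constants $0<\Lambda^-\le\Lambda^+$, $\Lambda^-\le\Lambda(s)\le\Lambda^+$ for all $s>0$. Let $\Omega$ be a domain in $\mathbb{C}$ and let $f:\Omega\to\mathbb{C}$ be a continuous function in $\Omega$. Then $f$ is a contact solution of $$f_{\overline z}+\frac{\Lambda(|f|)-1}{\Lambda(|f|)+1}\,\frac{f}{\overline f}\,\overline f_{\overline z}=0\quad\text{in }\Omega$$ if and only if $f$ satisfies the contact asymptotic mean value property (CAMVP) in $\Omega$.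
   Context: Notation: $D_r(z)$ is the disk in $\mathbb{C}$ centered at $z$ with radius $r$; $dS_\zeta$ is arc length; $\mathbb{S}^1\subset\mathbb{C}$ is the unit circle. For $\xi,\eta\in\mathbb{C}$ let $\xi\vee\eta$ be the symmetric real $2\times2$ matrix $$\xi\vee\eta=\frac12\begin{bmatrix}2(\mathrm{Re}\,\xi)(\mathrm{Re}\,\eta)&\mathrm{Im}(\xi\eta)\\ \mathrm{Im}(\xi\eta)&2(\mathrm{Im}\,\xi)(\mathrm{Im}\,\eta)\end{bmatrix}.$$ Contact jets: for a continuous $f:\Omega\to\mathbb{C}$, $z\in\Omega$ and $\xi\in\mathbb{S}^1$, the first contact $\xi$-jet $J^{1,\xi}_{\mathbb C}f(z)$ is the set of pairs $(\sigma,\tau)\in\mathbb{C}\times\mathbb{C}$ such that $$\xi\vee\left[f(\zeta)-f(z)-\sigma(\zeta-z)-\tau\,\overline{(\zeta-z)}\right]\le o(|\zeta-z|)\quad\text{as }\zeta\to z,$$ meaning that there is a continuous map $M$ from $\mathbb{C}\setminus\{0\}$ to the symmetric real $2\times2$ matrices with $|M(w)|/|w|\to0$ as $w\to0$ and such that, for $\zeta$ near $z$, $M(\zeta-z)$ bounds the matrix on the left-hand side from above in the sense of symmetric matrices. Operator: for $\omega\in\mathbb{C}\setminus\{0\}$ and $\sigma,\tau\in\mathbb{C}$, $$\mathbb{F}(\omega;\sigma,\tau)=\tau+\frac{\Lambda(|\omega|)-1}{\Lambda(|\omega|)+1}\,\frac{\omega}{\overline\omega}\,\overline\sigma .$$ Contact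 solution: a continuous $f:\Omega\to\mathbb{C}$ is a contact solution of the equation in the claim, in $\Omega$, if for every $z\in\Omega$ with $f(z)\neq0$ and every $\xi\in\mathbb{S}^1$, $$\mathrm{Re}\left[\overline\xi\,\mathbb{F}(f(z);\sigma,\tau)\right]\ge0\quad\text{for any }(\sigma,\tau)\in J^{1,\xi}_{\mathbb C}f(z).$$ Mean: for a continuous function $h$ on a neighborhood of $\overline{D_r(z)}$, let $(a^{\mathcal G}(h,r)(z),b^{\mathcal G}(h,r)(z))$ be the unique minimum point on $\mathbb{C}\times\mathbb{C}$ of $$\mathcal{G}(a,b)=\int_{\partial D_r(z)}\left[F\bigl(|h(\zeta)-a|\bigr)+F\bigl(|h(\zeta)-b\,\overline{(\zeta-z)}|\bigr)\right]dS_\zeta,$$ and set $\mu^{\mathcal G}(h,r)(z)=a^{\mathcal G}(h,r)(z)+r\,b^{\mathcal G}(h,r)(z)$. CAMVP: $f$ satisfies the contact asymptotic mean value property in $\Omega$ if for every $z\in\Omega$ with $f(z)\neq0$ and every $\xi\in\mathbb{S}^1$, $$\mathrm{Re}\left\{\overline\xi\left[\mu^{\mathcal G}(f_a,r)(z)-f(z)\right]\right\}\ge o(r)\quad\text{as }r\to0^+$$ for every $(\sigma,\tau)\in J^{1,\xi}_{\mathbb C}f(z)$, where $f_a(\zeta)=f(z)+\sigma(\zeta-z)+\tau\,\overline{(\zeta-z)}$. Here ''$\ge o(r)$'' means that the left-hand side is bounded below by some function of $r$ that is $o(r)$ as $r\to0^+$. *)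

(* Defs.v *)
From Stdlib Require Import Reals ClassicalEpsilon.
From Coquelicot Require Import Coquelicot.

Open Scope R_scope.

Definition connected_set (Om : C -> Prop) : Prop :=
  forall U V : C -> Prop, open U -> open V ->
    (forall z, Om z -> U z \/ V z) ->
    (exists z, Om z /\ U z) -> (exists z, Om z /\ V z) ->
    exists z, Om z /\ U z /\ V z.

Definition planar_domain (Om : C -> Prop) : Prop :=
  open Om /\ connected_set Om /\ exists z, Om z.

(** [F] is a total function on [R]; only its values on [[0, +oo)] matter. *)

(** The derivative of [F] relative to [[0, +oo)] (one-sided at [0]) exists and
    is continuous on [[0, +oo)]. *)
Definition C1_closed_half_line (F : R -> R) : Prop :=
  exists F1 : R -> R, forall s, 0 <= s ->
    D_in F F1 (Rle 0) s /\ continue_in F1 (Rle 0) s.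

Definition C2_open_half_line (F : R -> R) : Prop :=
  forall s, 0 < s -> ex_derive_n F 2 s /\ continuous (Derive_n F 2) s.

Definition strictly_convex_half_line (F : R -> R) : Prop :=
  forall x y t, 0 <= x -> 0 <= y -> x <> y -> 0 < t < 1 ->
    F (t * x + (1 - t) * y) < t * F x + (1 - t) * F y.

Definition Lambda (F : R -> R) (s : R) : R :=
  s * Derive_n F 2 s / Derive F s.

Notation mat2 := (@matrix R 2 2).

Definition entry (A : mat2) (i j : nat) : R := coeff_mat 0 A i j.

Definition mat2_symmetric (A : mat2) : Prop := entry A 0 1 = entry A 1 0.

(** Coquelicot puts no topology on matrices: continuity is entrywise. *)
Definition mat2_continuous (M : C -> mat2) (w : C) : Prop :=
  forall i j, (i < 2)%nat -> (j < 2)%nat -> continuous (fun u => entry (M u) i j) w.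

(** Frobenius norm *)
Definition mat2_norm (A : mat2) : R :=
  sqrt (entry A 0 0 ^ 2 + entry A 0 1 ^ 2 + entry A 1 0 ^ 2 + entry A 1 1 ^ 2).

Definition quad (A : mat2) (x y : R) : R :=
  entry A 0 0 * x * x + entry A 0 1 * x * y
  + entry A 1 0 * y * x + entry A 1 1 * y * y.

(** Loewner order *)
Definition mat2_le (A B : mat2) : Prop :=
  forall x y : R, quad A x y <= quad B x y.

Definition vee (xi eta : C) : mat2 :=
  mk_matrix 2 2 (fun i j =>
    match i, j with
    | O, O => / 2 * (2 * Re xi * Re eta)
    | S _, S _ => / 2 * (2 * Im xi * Im eta)
    | _, _ => / 2 * Im (xi * eta)%C
    end).

Definition unit_circle (xi : C) : Prop := Cmod xi = 1.

(** [f] is a total function on [C]; since the domains considered are open,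
    only its values on the domain matter near a point [z] of the domain. *)
Definition contact_jet (f : C -> C) (xi z sigma tau : C) : Prop :=
  exists M : C -> mat2,
    (forall w, w <> RtoC 0 -> mat2_symmetric (M w) /\ mat2_continuous M w) /\
    filterlim (fun w => mat2_norm (M w) / Cmod w)
      (locally' (RtoC 0)) (locally 0) /\
    locally' z (fun zeta =>
      mat2_le
        (vee xi (f zeta - f z - sigma * (zeta - z) - tau * Cconj (zeta - z))%C)
        (M (zeta - z)%C)).

Definition operatorF (F : R -> R) (omega sigma tau : C) : C :=
  (tau + RtoC ((Lambda F (Cmod omega) - 1) / (Lambda F (Cmod omega) + 1))%R
         * (omega / Cconj omega) * Cconj sigma)%C.

(** Contact solutions in [Om] of
    [f_zbar + (Lambda(|f|) - 1) / (Lambda(|f|) + 1) * (f / conj f)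
      * (conj f)_zbar = 0]. *)
Definition contact_solution (F : R -> R) (Om : C -> Prop) (f : C -> C) : Prop :=
  forall z, Om z -> f z <> RtoC 0 ->
  forall xi, unit_circle xi ->
  forall sigma tau, contact_jet f xi z sigma tau ->
    0 <= Re (Cconj xi * operatorF F (f z) sigma tau)%C.

(** Arc length: the parametrization [z + r e^(it)] has speed [r]. *)
Definition circle_integral (z : C) (r : R) (g : C -> R) : R :=
  RInt (fun t => g (z + RtoC r * (cos t, sin t))%C * r) 0 (2 * PI).

Definition energy (F : R -> R) (h : C -> C) (r : R) (z : C) (p : C * C) : R :=
  circle_integral z r (fun zeta =>
    F (Cmod (h zeta - fst p)%C)
    + F (Cmod (h zeta - snd p * Cconj (zeta - z))%C)).

Definition is_minimum_point (Phi : C * C -> R) (p : C * C) : Prop :=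
  forall q, Phi p <= Phi q.

(** The unique minimum point of the energy; [epsilon] only serves to turn the
    description into a total function. *)
Definition mean_pair (F : R -> R) (h : C -> C) (r : R) (z : C) : C * C :=
  epsilon (inhabits (RtoC 0, RtoC 0)) (unique (is_minimum_point (energy F h r z))).

Definition mean (F : R -> R) (h : C -> C) (r : R) (z : C) : C :=
  (fst (mean_pair F h r z) + RtoC r * snd (mean_pair F h r z))%C.

Definition affine_map (f : C -> C) (z sigma tau : C) (zeta : C) : C :=
  (f z + sigma * (zeta - z) + tau * Cconj (zeta - z))%C.

Definition CAMVP (F : R -> R) (Om : C -> Prop) (f : C -> C) : Prop :=
  forall z, Om z -> f z <> RtoC 0 ->
  forall xi, unit_circle xi ->
  forall sigma tau, contact_jet f xi z sigma tau ->
    exists e : R -> R,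
      is_domin (at_right 0) (fun r : R => r) e /\
      at_right 0 (fun r =>
        e r <= Re (Cconj xi * (mean F (affine_map f z sigma tau) r z - f z))%C).

(* Main.v *)
Require Import Defs.
From Stdlib Require Import Reals ClassicalEpsilon Classical List Lra Psatz.
From Coquelicot Require Import Coquelicot.

(** The jets play no role beyond being the same on both sides: for every
    [sigma] and [tau], and every point [z] with [v = f z] not zero, the mean of
    the affine map [f_a] satisfies
    [mean F f_a r z = v + r operatorF F v sigma tau + o(r)]
    ([mean_affine_map_expansion]).  Pairing with [xi] and dividing by [r], the
    lower bound by [o(r)] holds exactly when
    [Re (conj xi * operatorF F v sigma tau)] is nonnegative.

    The energy splits into a term in [a] and a term in [b]
    ([energy_affine_map]), both integrals over [t] of
    [F |A + B e^(it) + D e^(-it)|].  In the first one the linear part is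
    [B e^(it) + D e^(-it)] with [B = r sigma], [D = r tau]; it changes sign
    under [t |-> t + pi], and strict convexity of [F |.|] makes [a = v] the
    strict minimum point ([circle_energy_centre]).

    In the second one [A = v], [B = r sigma] and [D = r (tau - b)].  Away from
    the origin the function [F |.|] has a second-order Taylor expansion, the
    linear term integrates to zero, and the average of the quadratic term is a
    quadratic form in [(B, D)] which, for fixed [B], is a positive multiple of
    [|D - D0|^2] up to a constant; the positive factor is a quarter of
    [F''(|v|) + F'(|v|) / |v|], and [D0 = r (tau - operatorF F v sigma tau)]
    ([mean_quadratic_complete_square]).  Hence, for [r] small, the energy is
    larger on the circle of radius [r eps] about [D0] than at [D0], and by
    convexity it is larger outside that circle too ([circle_energy_growth]).  So
    a minimum point exists by compactness, it lies within [r eps] of [D0], and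
    strict convexity makes it unique ([circle_energy_unique_minimum]). *)

(** * Convex profiles and their radial extensions *)

(** The part of the hypotheses on [F] that concerns convexity; it already makes
    [F] increasing and locally Lipschitz on the half line, including at [0]. *)
Definition convex_profile (F : R -> R) : Prop :=
  (forall s, 0 <= s -> 0 <= F s) /\ strictly_convex_half_line F /\ F 0 = 0.

Lemma convex_profile_pos F s : convex_profile F -> 0 < s -> 0 < F s.
Proof.
  intros (Hp & Hc & H0) Hs.
  pose proof (Hc s 0 (/2) ltac:(lra) ltac:(lra) ltac:(lra) ltac:(lra)) as H.
  pose proof (Hp (/2 * s + (1 - /2) * 0) ltac:(lra)).
  rewrite H0 in H; lra.
Qed.

Lemma convex_profile_increasing F s t :
  convex_profile F -> 0 <= s < t -> F s < F t.
Proof.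
  intros HF [Hs Hst].
  pose proof (convex_profile_pos F t HF ltac:(lra)) as Ht.
  destruct HF as (Hp & Hc & H0).
  destruct (Req_dec s 0) as [->|Hs0]; [rewrite H0; lra|].
  assert (Hl : 0 < s / t < 1).
  { split; [apply Rdiv_lt_0_compat; lra|].
    apply Rmult_lt_reg_r with t; [lra|]; field_simplify; lra. }
  pose proof (Hc t 0 (s / t) ltac:(lra) ltac:(lra) ltac:(lra) Hl) as H.
  replace (s / t * t + (1 - s / t) * 0) with s in H by (field; lra).
  rewrite H0 in H; nra.
Qed.

Lemma convex_profile_le F s t :
  convex_profile F -> 0 <= s <= t -> F s <= F t.
Proof.
  intros HF [Hs [Hst| ->]]; [|lra].
  left; apply convex_profile_increasing; auto.
Qed.

(** The slope over [[s, t]] is at most the slope over [[s, t + 1]], whose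
    denominator is at least [1] and whose numerator is at most [F (K + 1)]. *)
Lemma convex_profile_slope F K s t :
  convex_profile F -> 0 <= s < t -> t <= K -> F t - F s <= F (K + 1) * (t - s).
Proof.
  intros HF Hst HK.
  pose proof (convex_profile_le F (t + 1) (K + 1) HF ltac:(lra)) as HK1.
  destruct HF as (Hp & Hc & H0).
  pose proof (Hp s ltac:(lra)) as Hs.
  pose proof (Hp (t + 1) ltac:(lra)) as Ht.
  set (l := / (t + 1 - s)).
  assert (Hl1 : l * (t + 1 - s) = 1) by (unfold l; field; lra).
  assert (Hl0 : 0 < l) by (apply Rinv_0_lt_compat; lra).
  assert (Hl2 : l < 1) by nra.
  pose proof (Hc s (t + 1) l ltac:(lra) ltac:(lra) ltac:(lra) ltac:(lra)) as H.
  replace (l * s + (1 - l) * (t + 1)) with t in H by nra.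
  assert (H1 : 1 - l = l * (t - s)) by nra.
  assert (H2 : 1 - l <= t - s) by nra.
  nra.
Qed.

Lemma convex_profile_lipschitz F K s t :
  convex_profile F -> 0 <= s <= K -> 0 <= t <= K ->
  Rabs (F s - F t) <= F (K + 1) * Rabs (s - t).
Proof.
  intros HF Hs Ht.
  destruct (Rtotal_order s t) as [H|[->|H]].
  - rewrite (Rabs_left (s - t)) by lra.
    pose proof (convex_profile_increasing F s t HF ltac:(lra)).
    pose proof (convex_profile_slope F K s t HF ltac:(lra) ltac:(lra)).
    rewrite Rabs_left by lra; lra.
  - rewrite !Rminus_diag, Rabs_R0; lra.
  - rewrite (Rabs_right (s - t)) by lra.
    pose proof (convex_profile_increasing F t s HF ltac:(lra)).
    pose proof (convex_profile_slope F K t s HF ltac:(lra) ltac:(lra)).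
    rewrite Rabs_right by lra; lra.
Qed.

Lemma Cmod_sub_abs (p q : C) : Rabs (Cmod p - Cmod q) <= Cmod (p - q)%C.
Proof.
  pose proof (Cmod_triangle (p - q)%C q) as H1.
  pose proof (Cmod_triangle (q - p)%C p) as H2.
  replace (p - q + q)%C with p in H1 by ring.
  replace (q - p + p)%C with q in H2 by ring.
  replace (q - p)%C with (- (p - q))%C in H2 by ring.
  rewrite Cmod_opp in H2.
  apply Rabs_le; lra.
Qed.

Lemma radial_lipschitz F K (p q : C) :
  convex_profile F -> Cmod p <= K -> Cmod q <= K ->
  Rabs (F (Cmod p) - F (Cmod q)) <= F (K + 1) * Cmod (p - q)%C.
Proof.
  intros HF Hp Hq.
  pose proof (Cmod_ge_0 p) as Hp0.
  eapply Rle_trans.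
  - apply (convex_profile_lipschitz F K); auto; split; auto using Cmod_ge_0.
  - apply Rmult_le_compat_l, Cmod_sub_abs.
    apply HF; lra.
Qed.

(** If the moduli differ, strictness comes from the profile; if they agree, the
    disk is strictly convex and the profile is strictly increasing. *)
Lemma radial_strictly_convex F (p q : C) (l : R) :
  convex_profile F -> p <> q -> 0 < l < 1 ->
  F (Cmod (RtoC l * p + RtoC (1 - l) * q)%C)
    < l * F (Cmod p) + (1 - l) * F (Cmod q).
Proof.
  intros HF Hpq Hl.
  pose proof (Cmod_ge_0 p) as Hp0; pose proof (Cmod_ge_0 q) as Hq0.
  set (m := (RtoC l * p + RtoC (1 - l) * q)%C).
  pose proof (Cmod_ge_0 m) as Hm0.
  assert (Hm : Cmod m <= l * Cmod p + (1 - l) * Cmod q).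
  { unfold m; eapply Rle_trans; [apply Cmod_triangle|].
    rewrite !Cmod_mult, !Cmod_R, !Rabs_right by lra; lra. }
  destruct (Req_dec (Cmod p) (Cmod q)) as [He|He].
  - assert (Hd : 0 < Cmod (p - q)%C).
    { apply Cmod_gt_0; intros H; apply Hpq.
      replace p with ((p - q) + q)%C by ring; rewrite H; ring. }
    assert (Hsq : Cmod m ^ 2 = l * Cmod p ^ 2 + (1 - l) * Cmod q ^ 2
                    - l * (1 - l) * Cmod (p - q)%C ^ 2).
    { rewrite !Cmod2_alt; unfold m; destruct p, q; unfold Re, Im; simpl; ring. }
    rewrite <- He in *.
    replace (l * F (Cmod p) + (1 - l) * F (Cmod p)) with (F (Cmod p)) by ring.
    apply convex_profile_increasing; auto; split; auto.
    assert (0 < l * (1 - l) * Cmod (p - q)%C ^ 2)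
      by (apply Rmult_lt_0_compat; [nra|apply pow_lt; auto]).
    nra.
  - eapply Rle_lt_trans.
    + apply (convex_profile_le F (Cmod m)); auto; split; [auto|apply Hm].
    + apply HF; auto.
Qed.

(** * Integrals over a circle of a radial function of a real affine map *)

(** The value at [e^(it)] of the real affine map [w |-> A + B w + D conj w]. *)
Definition circle_affine (A B D : C) (t : R) : C :=
  (A + B * (cos t, sin t) + D * Cconj (cos t, sin t))%C.

(** The integral over [t] of [F |A + B e^(it) + D e^(-it)|]. *)
Definition circle_energy (F : R -> R) (A B D : C) : R :=
  RInt (fun t => F (Cmod (circle_affine A B D t))) 0 (2 * PI).

Lemma Cmod_cos_sin t : Cmod (cos t, sin t) = 1.
Proof.
  unfold Cmod; simpl.
  replace (cos t * (cos t * 1) + sin t * (sin t * 1)) with 1; [apply sqrt_1|].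
  pose proof (sin2_cos2 t); unfold Rsqr in *; lra.
Qed.

Lemma Cmod_conj_cos_sin t : Cmod (Cconj (cos t, sin t)) = 1.
Proof. rewrite Cmod_conj; apply Cmod_cos_sin. Qed.

Lemma continuous_radial F (x y : R -> R) t :
  convex_profile F -> continuous x t -> continuous y t ->
  continuous (fun u => F (Cmod (x u, y u))) t.
Proof.
  intros HF Hx Hy.
  assert (Hc : continuous (fun u => Cmod (x u, y u)) t).
  { unfold Cmod; simpl; apply continuous_sqrt_comp.
    apply (@continuous_plus R_UniformSpace R_AbsRing R_NormedModule).
    - apply (continuous_mult x (fun u => x u * 1)); auto.
      apply (continuous_mult x (fun _ => 1)); auto; apply continuous_const.
    - apply (continuous_mult y (fun u => y u * 1)); auto.
      apply (continuous_mult y (fun _ => 1)); auto; apply continuous_const. }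
  (* the values of F at negative arguments are arbitrary, hence the even
     extension *)
  apply (continuous_ext (fun u => (fun s => F (Rabs s)) (Cmod (x u, y u)))).
  { intros u; simpl; rewrite Rabs_right; auto; apply Rle_ge, Cmod_ge_0. }
  apply (continuous_comp (fun u => Cmod (x u, y u)) (fun s => F (Rabs s))); auto.
  generalize (Cmod (x t, y t)); clear - HF; intros s.
  apply continuity_pt_filterlim; intros eps Heps.
  set (L := F (Rabs s + 1 + 1)).
  assert (HL : 0 < L).
  { apply convex_profile_pos; auto; pose proof (Rabs_pos s); lra. }
  exists (Rmin 1 (eps / L)); split.
  { apply Rmin_glb_lt; [lra|]; apply Rdiv_lt_0_compat; auto. }
  intros u [_ Hu]; simpl in *; unfold R_dist in *.
  pose proof (Rabs_triang_inv u s) as H1.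
  pose proof (Rmin_l 1 (eps / L)); pose proof (Rmin_r 1 (eps / L)).
  eapply Rle_lt_trans.
  - apply (convex_profile_lipschitz F (Rabs s + 1)); auto; split;
      auto using Rabs_pos; lra.
  - fold L; eapply Rle_lt_trans.
    + apply Rmult_le_compat_l; [lra|]; apply Rabs_triang_inv2.
    + apply Rlt_le_trans with (L * (eps / L)); [|right; field; lra].
      apply Rmult_lt_compat_l; lra.
Qed.

Lemma continuous_circle_energy F A B D t :
  convex_profile F -> continuous (fun u => F (Cmod (circle_affine A B D u))) t.
Proof.
  intros HF.
  assert (Hc : continuous cos t) by apply continuous_cos.
  assert (Hs : continuous sin t) by apply continuous_sin.
  apply (continuous_ext (fun u =>
    F (Cmod (Re (circle_affine A B D u), Im (circle_affine A B D u))))).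
  { intros u; destruct (circle_affine A B D u); auto. }
  apply continuous_radial; auto; unfold circle_affine; simpl;
    apply (@ex_derive_continuous R_AbsRing R_NormedModule); auto_derive; auto.
Qed.

Lemma ex_RInt_circle_energy F A B D a b :
  convex_profile F -> ex_RInt (fun u => F (Cmod (circle_affine A B D u))) a b.
Proof.
  intros HF; apply (@ex_RInt_continuous R_CompleteNormedModule).
  intros t _; apply continuous_circle_energy; auto.
Qed.

Lemma circle_energy_strictly_convex F A B D D' l :
  convex_profile F -> D <> D' -> 0 < l < 1 ->
  circle_energy F A B (RtoC l * D + RtoC (1 - l) * D')%C
    < l * circle_energy F A B D + (1 - l) * circle_energy F A B D'.
Proof.
  intros HF HD Hl; unfold circle_energy.
  set (g := fun D u => F (Cmod (circle_affine A B D u))).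
  assert (Hg : forall D a b, ex_RInt (g D) a b)
    by (intros; apply ex_RInt_circle_energy; auto).
  change (RInt (g (RtoC l * D + RtoC (1 - l) * D')%C) 0 (2 * PI)
    < scal l (RInt (g D) 0 (2 * PI)) + scal (1 - l) (RInt (g D') 0 (2 * PI))).
  pose proof PI_RGT_0.
  rewrite <- !RInt_scal by auto.
  change Rplus with (@plus R_AbelianMonoid).
  rewrite <- (@RInt_plus R_CompleteNormedModule) by (apply (@ex_RInt_scal R_NormedModule); auto).
  apply RInt_lt; try lra.
  - intros t _; apply (@continuous_plus R_UniformSpace R_AbsRing R_NormedModule); apply (@continuous_scal_r R_UniformSpace R_AbsRing R_NormedModule);
      apply continuous_circle_energy; auto.
  - intros t _; apply continuous_circle_energy; auto.
  - intros t _; unfold g, plus, scal; simpl; unfold mult; simpl.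
    replace (circle_affine A B (RtoC l * D + RtoC (1 - l) * D')%C t)
      with (RtoC l * circle_affine A B D t
            + RtoC (1 - l) * circle_affine A B D' t)%C.
    + apply radial_strictly_convex; auto; intros He; apply HD.
      unfold circle_affine in He.
      assert (Hz : ((D - D') * Cconj (cos t, sin t))%C = RtoC 0).
      { replace ((D - D') * Cconj (cos t, sin t))%C with
          ((A + B * (cos t, sin t) + D * Cconj (cos t, sin t)) -
           (A + B * (cos t, sin t) + D' * Cconj (cos t, sin t)))%C by ring.
        rewrite He; ring. }
      assert (Hn : Cmod (D - D')%C = 0).
      { rewrite <- (Rmult_1_r (Cmod _)), <- (Cmod_conj_cos_sin t), <- Cmod_mult, Hz.
        apply Cmod_0. }
      apply Cmod_eq_0 in Hn.
      replace D with ((D - D') + D')%C by ring; rewrite Hn; ring.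
    + unfold circle_affine; rewrite RtoC_minus; ring.
Qed.

Lemma Cmod_circle_affine_le A B D t :
  Cmod (circle_affine A B D t) <= Cmod A + Cmod B + Cmod D.
Proof.
  unfold circle_affine.
  eapply Rle_trans; [apply Cmod_triangle|].
  rewrite Cmod_mult, Cmod_conj_cos_sin, Rmult_1_r; apply Rplus_le_compat_r.
  eapply Rle_trans; [apply Cmod_triangle|].
  rewrite Cmod_mult, Cmod_cos_sin; lra.
Qed.

Lemma circle_energy_lipschitz F A B D D' K :
  convex_profile F -> Cmod D <= K -> Cmod D' <= K ->
  Rabs (circle_energy F A B D - circle_energy F A B D')
    <= 2 * PI * F (Cmod A + Cmod B + K + 1) * Cmod (D - D')%C.
Proof.
  intros HF HD HD'; unfold circle_energy.
  set (g := fun D u => F (Cmod (circle_affine A B D u))).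
  assert (Hg : forall D a b, ex_RInt (g D) a b)
    by (intros; apply ex_RInt_circle_energy; auto).
  pose proof PI_RGT_0.
  change (Rabs (minus (RInt (g D) 0 (2 * PI)) (RInt (g D') 0 (2 * PI)))
    <= 2 * PI * F (Cmod A + Cmod B + K + 1) * Cmod (D - D')%C).
  rewrite <- (@RInt_minus R_CompleteNormedModule) by auto.
  eapply Rle_trans.
  - apply (abs_RInt_le_const _ _ _ (F (Cmod A + Cmod B + K + 1) * Cmod (D - D')%C)).
    + lra.
    + apply (@ex_RInt_minus R_NormedModule); auto.
    + intros t _; unfold g, minus, plus, opp; simpl.
      replace (Cmod (D - D')%C)
        with (Cmod (circle_affine A B D t - circle_affine A B D' t)%C).
      * apply radial_lipschitz; auto;
          (eapply Rle_trans; [apply Cmod_circle_affine_le|lra]).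
      * unfold circle_affine.
        replace (A + B * (cos t, sin t) + D * Cconj (cos t, sin t) -
           (A + B * (cos t, sin t) + D' * Cconj (cos t, sin t)))%C
          with ((D - D') * Cconj (cos t, sin t))%C by ring.
        rewrite Cmod_mult, Cmod_conj_cos_sin; ring.
  - right; ring.
Qed.

Lemma RInt_fold_half_circle (g : R -> R) :
  (forall t, continuous g t) ->
  RInt g 0 (2 * PI) = RInt (fun t => g t + g (t + PI)) 0 PI.
Proof.
  intros Hg.
  assert (Hi : forall a b, ex_RInt g a b)
    by (intros; apply (@ex_RInt_continuous R_CompleteNormedModule); auto).
  rewrite <- (RInt_Chasles g 0 PI (2 * PI)) by auto.
  pose proof (RInt_comp_lin g 1 PI 0 PI (Hi _ _)) as H.
  replace (1 * 0 + PI) with PI in H by ring.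
  replace (1 * PI + PI) with (2 * PI) in H by ring.
  rewrite <- H.
  rewrite <- (@RInt_plus R_CompleteNormedModule).
  - apply RInt_ext; intros t _; unfold plus, scal; simpl; unfold mult; simpl.
    rewrite !Rmult_1_l; auto.
  - auto.
  - apply (@ex_RInt_continuous R_CompleteNormedModule); intros t _.
    apply (@continuous_scal_r R_UniformSpace R_AbsRing R_NormedModule).
    apply (continuous_comp (fun t => 1 * t + PI) g); auto.
    apply (@ex_derive_continuous R_AbsRing R_NormedModule); auto_derive; auto.
Qed.

(** Antipodal points pair up the values [F |k + A|] and [F |k - A|], where
    [k = B e^(it) + D e^(-it)]. *)
Lemma circle_energy_centre F A B D :
  convex_profile F -> A <> RtoC 0 ->
  circle_energy F (RtoC 0) B D < circle_energy F A B D.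
Proof.
  intros HF HA; unfold circle_energy.
  pose proof PI_RGT_0.
  rewrite !RInt_fold_half_circle
    by (intros; apply continuous_circle_energy; auto).
  assert (Hsh : forall A t, Cmod (circle_affine A B D (t + PI))
                            = Cmod (circle_affine (- A)%C B D t)).
  { intros A' t; rewrite <- Cmod_opp; f_equal.
    unfold circle_affine; rewrite neg_cos, neg_sin.
    apply injective_projections; simpl; ring. }
  assert (Hc : forall A t, continuous (fun t => F (Cmod (circle_affine A B D t)) +
       F (Cmod (circle_affine A B D (t + PI)))) t).
  { intros A' t; apply (@continuous_plus R_UniformSpace R_AbsRing R_NormedModule); [apply continuous_circle_energy; auto|].
    apply (continuous_ext (fun t => F (Cmod (circle_affine (- A')%C B D t)))).
    - intros u; rewrite Hsh; auto.
    - apply continuous_circle_energy; auto. }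
  apply RInt_lt; auto.
  intros t _; rewrite !Hsh.
  assert (Hne : circle_affine A B D t <> circle_affine (- A)%C B D t).
  { intros He; apply HA; unfold circle_affine in He.
    assert (H2 : (RtoC 2 * A)%C = RtoC 0).
    { replace (RtoC 2 * A)%C with
        ((A + B * (cos t, sin t) + D * Cconj (cos t, sin t)) -
         (- A + B * (cos t, sin t) + D * Cconj (cos t, sin t)))%C.
      - rewrite He; ring.
      - apply injective_projections; simpl; ring. }
    destruct A as [a1 a2]; injection H2; intros; apply injective_projections;
      simpl; lra. }
  pose proof (radial_strictly_convex F _ _ (/2) HF Hne ltac:(lra)) as Hm.
  replace (RtoC (/ 2) * circle_affine A B D t +
          RtoC (1 - / 2) * circle_affine (- A) B D t)%C
    with (circle_affine (RtoC 0) B D t) in Hm.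
  - replace (- RtoC 0)%C with (RtoC 0) by ring; lra.
  - unfold circle_affine; apply injective_projections; simpl; field.
Qed.

(** * Second-order expansion of the energy *)

Lemma taylor_second_order (F : R -> R) s eta :
  locally s (fun t => ex_derive F t) -> ex_derive (Derive F) s -> 0 < eta ->
  exists delta, 0 < delta /\ forall h, Rabs h <= delta ->
    Rabs (F (s + h) - (F s + Derive F s * h + Derive_n F 2 s / 2 * h ^ 2))
      <= eta * h ^ 2.
Proof.
  intros [d1 Hd1] H2 Heta.
  apply Derive_correct, is_derive_Reals in H2.
  destruct (H2 eta Heta) as [d2 Hd2].
  change (Derive (Derive F) s) with (Derive_n F 2 s) in Hd2.
  set (k1 := Derive F s) in *; set (k2 := Derive_n F 2 s) in *.
  pose proof (cond_pos d1); pose proof (cond_pos d2).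
  pose proof (Rmin_l d1 d2); pose proof (Rmin_r d1 d2).
  assert (Hd : 0 < Rmin d1 d2) by (apply Rmin_glb_lt; auto).
  exists (Rmin d1 d2 / 2); split; [lra|]; intros h Hh.
  assert (Hder : forall k, Rabs k <= Rmin d1 d2 / 2 ->
     is_derive (fun k => F (s + k) - k1 * k - k2 / 2 * k ^ 2) k
       (Derive F (s + k) - k1 - k2 * k)).
  { intros k Hk.
    assert (ex_derive F (s + k)).
    { apply Hd1; unfold ball; simpl; unfold AbsRing_ball, abs, minus, plus, opp;
        simpl; replace (s + k + - s) with k by ring; lra. }
    auto_derive; [auto|]; simpl; change (Derive (fun x : R => F x)) with (Derive F); field. }
  assert (Hin : forall x, Rmin 0 h <= x <= Rmax 0 h -> Rabs x <= Rabs h).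
  { intros x; unfold Rmin, Rmax; destruct (Rle_dec 0 h); intros ?.
    - rewrite !Rabs_right; lra.
    - rewrite !Rabs_left1; lra. }
  destruct (MVT_gen (fun k => F (s + k) - k1 * k - k2 / 2 * k ^ 2) 0 h
     (fun k => Derive F (s + k) - k1 - k2 * k)) as (c & Hc & He).
  - intros x Hx; apply Hder; specialize (Hin x ltac:(lra)); lra.
  - intros x Hx; specialize (Hin x Hx).
    apply continuity_pt_filterlim.
    apply (@ex_derive_continuous R_AbsRing R_NormedModule
             (fun k => F (s + k) - k1 * k - k2 / 2 * k ^ 2)).
    exact (ex_intro _ _ (Hder x ltac:(lra))).
  - specialize (Hin c Hc).
    replace (F (s + h) - (F s + k1 * h + k2 / 2 * h ^ 2))
      with ((Derive F (s + c) - k1 - k2 * c) * h).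
    + rewrite Rabs_mult, <- (pow2_abs h).
      assert (Hb : Rabs (Derive F (s + c) - k1 - k2 * c) <= eta * Rabs c).
      { destruct (Req_dec c 0) as [->|Hc0].
        - rewrite Rplus_0_r; fold k1.
          replace (k1 - k1 - k2 * 0) with 0 by ring.
          rewrite Rabs_R0; lra.
        - specialize (Hd2 c Hc0 ltac:(lra)).
          replace (Derive F (s + c) - k1 - k2 * c) with
            (((Derive F (s + c) - k1) / c - k2) * c) by (field; auto).
          rewrite Rabs_mult; apply Rmult_le_compat_r; [apply Rabs_pos|lra]. }
      pose proof (Rabs_pos h); pose proof (Rabs_pos c).
      assert (eta * Rabs c <= eta * Rabs h) by (apply Rmult_le_compat_l; lra).
      nra.
    + rewrite Rminus_0_r in He; rewrite <- He.
      rewrite Rplus_0_r; ring.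
Qed.

(** The Euclidean inner product of the plane. *)
Definition dot (p q : C) : R := Re p * Re q + Im p * Im q.

(** The second-order Taylor polynomial of [p |-> F |v + p|] at [0], for [v] not
    zero: with [x] the component of [p] along [v], the modulus [|v + p|] is
    [|v| + x + (|p|^2 - x^2) / (2 |v|)] up to third order. *)
Definition radial_taylor (F : R -> R) (v p : C) : R :=
  let s := Cmod v in
  let x := dot v p / s in
  F s + Derive F s * (x + (Cmod p ^ 2 - x ^ 2) / (2 * s))
  + Derive_n F 2 s / 2 * x ^ 2.

Lemma radial_taylor_bound F v eta :
  v <> RtoC 0 -> locally (Cmod v) (fun t => ex_derive F t) ->
  ex_derive (Derive F) (Cmod v) -> 0 < eta ->
  exists delta, 0 < delta /\ forall p, Cmod p <= delta ->
    Rabs (F (Cmod (v + p)%C) - radial_taylor F v p) <= eta * Cmod p ^ 2.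
Proof.
  intros Hv H1 H2 Heta.
  apply Cmod_gt_0 in Hv.
  destruct (taylor_second_order F (Cmod v) (eta / 2) H1 H2 ltac:(lra))
    as (d & Hd & HT).
  unfold radial_taylor.
  set (s := Cmod v) in *.
  set (k1 := Derive F s) in *; set (k2 := Derive_n F 2 s) in *.
  set (K := (Rabs k1 / (2 * s) + Rabs k2 / 2) / s).
  assert (HK : 0 <= K).
  { unfold K; pose proof (Rabs_pos k1); pose proof (Rabs_pos k2).
    apply Rdiv_le_0_compat; [|lra].
    apply Rplus_le_le_0_compat; [apply Rdiv_le_0_compat; lra|lra]. }
  exists (Rmin d (eta / 2 / (K + 1))); split.
  { apply Rmin_glb_lt; auto; apply Rdiv_lt_0_compat; lra. }
  intros p Hp.
  assert (Hpd : Cmod p <= d) by (eapply Rle_trans; [apply Hp|apply Rmin_l]).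
  assert (HpK : K * Cmod p <= eta / 2).
  { assert (Cmod p <= eta / 2 / (K + 1))
      by (eapply Rle_trans; [apply Hp|apply Rmin_r]).
    pose proof (Cmod_ge_0 p).
    apply Rle_trans with ((K + 1) * (eta / 2 / (K + 1))); [|right; field; lra].
    apply Rmult_le_compat; lra. }
  set (h := Cmod (v + p)%C - s).
  assert (Hh : Rabs h <= Cmod p).
  { unfold h, s; eapply Rle_trans; [apply Cmod_sub_abs|].
    right; f_equal; ring. }
  specialize (HT h ltac:(lra)).
  replace (s + h) with (Cmod (v + p)%C) in HT by (unfold h; ring).
  set (x := dot v p / s).
  assert (Hs2 : s ^ 2 = Re v ^ 2 + Im v ^ 2) by apply Cmod2_alt.
  assert (Hp2 : Cmod p ^ 2 = Re p ^ 2 + Im p ^ 2) by apply Cmod2_alt.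
  assert (Hxs : x * s = dot v p) by (unfold x; field; lra).
  assert (Hquad : h ^ 2 + 2 * s * h = 2 * (x * s) + Cmod p ^ 2).
  { rewrite Hxs.
    replace (h ^ 2 + 2 * s * h) with (Cmod (v + p)%C ^ 2 - s ^ 2)
      by (unfold h; ring).
    rewrite Hs2, Hp2, Cmod2_alt; unfold dot; destruct v, p; unfold Re, Im;
      simpl; ring. }
  assert (Hx : Rabs x <= Cmod p).
  { assert (Hx2 : x ^ 2 <= Cmod p ^ 2).
    { apply Rmult_le_reg_r with (s ^ 2); [apply pow_lt; auto|].
      replace (x ^ 2 * s ^ 2) with ((x * s) ^ 2) by ring.
      rewrite Hxs, Hs2, Hp2; unfold dot.
      pose proof (pow2_ge_0 (Re v * Im p - Im v * Re p)); nra. }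
    rewrite <- (Rabs_right (Cmod p)) by (apply Rle_ge, Cmod_ge_0).
    apply Rsqr_le_abs_0; unfold Rsqr; lra. }
  assert (Hhx : h - x = (Cmod p ^ 2 - h ^ 2) / (2 * s)).
  { apply Rmult_eq_reg_r with (2 * s); [|lra].
    unfold Rdiv; rewrite Rmult_assoc, Rinv_l by lra; lra. }
  pose proof (Cmod_ge_0 p) as Hp0.
  assert (Hh2 : h ^ 2 <= Cmod p ^ 2).
  { rewrite <- (pow2_abs h); apply pow_incr; split; [apply Rabs_pos|auto]. }
  assert (Hsq : Rabs (h ^ 2 - x ^ 2) <= Cmod p ^ 3 / s).
  { replace (h ^ 2 - x ^ 2) with ((h - x) * (h + x)) by ring.
    rewrite Rabs_mult.
    replace (Cmod p ^ 3 / s) with ((Cmod p ^ 2 / (2 * s)) * (2 * Cmod p))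
      by (field; lra).
    apply Rmult_le_compat; try apply Rabs_pos.
    - rewrite Hhx; unfold Rdiv.
      assert (Hi : 0 < / (2 * s)) by (apply Rinv_0_lt_compat; lra).
      pose proof (pow2_ge_0 h).
      rewrite Rabs_right by nra; nra.
    - pose proof (Rabs_triang h x); lra. }
  replace (F (Cmod (v + p)%C) - (F s + k1 * (x + (Cmod p ^ 2 - x ^ 2) / (2 * s))
            + k2 / 2 * x ^ 2))
    with ((F (Cmod (v + p)%C) - (F s + k1 * h + k2 / 2 * h ^ 2))
          + (k2 / 2 - k1 / (2 * s)) * (h ^ 2 - x ^ 2)).
  2: { replace h with (x + (Cmod p ^ 2 - h ^ 2) / (2 * s)) at 1 by lra.
       field; lra. }
  eapply Rle_trans; [apply Rabs_triang|].
  assert (Hk : Rabs (k2 / 2 - k1 / (2 * s)) <= K * s).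
  { unfold K; replace ((Rabs k1 / (2 * s) + Rabs k2 / 2) / s * s)
      with (Rabs k2 / 2 + Rabs k1 / (2 * s)) by (field; lra).
    eapply Rle_trans; [apply Rabs_triang|].
    rewrite Rabs_Ropp; unfold Rdiv; rewrite !Rabs_mult.
    rewrite (Rabs_right (/ 2)) by lra.
    rewrite (Rabs_right (/ (2 * s))) by (apply Rle_ge, Rlt_le, Rinv_0_lt_compat; lra).
    lra. }
  rewrite Rabs_mult.
  assert (Hlast : Rabs (k2 / 2 - k1 / (2 * s)) * Rabs (h ^ 2 - x ^ 2)
            <= eta / 2 * Cmod p ^ 2).
  { apply Rle_trans with (K * s * (Cmod p ^ 3 / s)).
    - apply Rmult_le_compat; auto using Rabs_pos.
    - replace (K * s * (Cmod p ^ 3 / s)) with (K * Cmod p * Cmod p ^ 2)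
        by (field; lra).
      apply Rmult_le_compat_r; auto; apply pow2_ge_0. }
  assert (eta / 2 * h ^ 2 <= eta / 2 * Cmod p ^ 2)
    by (apply Rmult_le_compat_l; lra).
  lra.
Qed.

Lemma is_RInt_trigonometric_quadratic a0 a1 a2 b0 b1 b2 :
  is_RInt (fun t => a0 + a1 * cos t + a2 * sin t + b0 * cos t ^ 2
                    + b1 * (cos t * sin t) + b2 * sin t ^ 2)
    0 (2 * PI) (2 * PI * a0 + PI * b0 + PI * b2).
Proof.
  set (P := fun t => a0 * t + a1 * sin t - a2 * cos t
     + b0 * (t + sin t * cos t) / 2 + b1 * (sin t ^ 2) / 2
     + b2 * (t - sin t * cos t) / 2).
  replace (2 * PI * a0 + PI * b0 + PI * b2) with (minus (P (2 * PI)) (P 0)).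
  - apply (@is_RInt_derive R_CompleteNormedModule); intros t _.
    + unfold P; auto_derive; auto.
      pose proof (sin2_cos2 t) as H; unfold Rsqr in H.
      apply Rminus_diag_uniq.
      transitivity ((b0 + b2) / 2 * (1 - (sin t * sin t + cos t * cos t)));
        [field|rewrite H; ring].
    + apply (@ex_derive_continuous R_AbsRing R_NormedModule); auto_derive; auto.
  - unfold P, minus, plus, opp; simpl.
    rewrite sin_2PI, cos_2PI, sin_0, cos_0; field.
Qed.

(** The average of [radial_taylor F v (B e^(it) + D e^(-it))] over [t] exceeds
    [F |v|] by this quadratic form. *)
Definition mean_quadratic (F : R -> R) (v B D : C) : R :=
  let s := Cmod v in
  (Derive_n F 2 s + Derive F s / s) / 4 * (Cmod B ^ 2 + Cmod D ^ 2)
  + (Derive_n F 2 s - Derive F s / s) / (2 * s ^ 2)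
    * Re (Cconj v * Cconj v * B * D)%C.

Lemma is_RInt_radial_taylor F v B D :
  v <> RtoC 0 ->
  is_RInt (fun t => radial_taylor F v (circle_affine (RtoC 0) B D t))
    0 (2 * PI) (2 * PI * (F (Cmod v) + mean_quadratic F v B D)).
Proof.
  intros Hv; apply Cmod_gt_0 in Hv.
  unfold radial_taylor, mean_quadratic; cbv zeta.
  set (s := Cmod v) in *.
  set (k1 := Derive F s) in *; set (k2 := Derive_n F 2 s) in *.
  assert (Hs2 : s ^ 2 = Re v ^ 2 + Im v ^ 2) by apply Cmod2_alt.
  rewrite !(Cmod2_alt B), !(Cmod2_alt D).
  destruct v as [v1 v2], B as [B1 B2], D as [D1 D2].
  unfold Re, Im in *; simpl fst in *; simpl snd in *.
  set (c3 := k1 / (2 * s)).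
  set (c2 := (k2 / 2 - k1 / (2 * s)) / s ^ 2).
  set (X := v1 * (B1 + D1) + v2 * (B2 + D2)).
  set (Y := v1 * (D2 - B2) + v2 * (B1 - D1)).
  apply is_RInt_ext with (fun t => F s + k1 / s * X * cos t + k1 / s * Y * sin t
     + (c2 * X ^ 2 + c3 * ((B1 + D1) ^ 2 + (B2 + D2) ^ 2)) * cos t ^ 2
     + (c2 * (2 * X * Y) + c3 * (2 * (B1 + D1) * (D2 - B2)
          + 2 * (B2 + D2) * (B1 - D1))) * (cos t * sin t)
     + (c2 * Y ^ 2 + c3 * ((D2 - B2) ^ 2 + (B1 - D1) ^ 2)) * sin t ^ 2).
  - intros t _.
    rewrite Cmod2_alt; unfold dot, circle_affine, Re, Im; simpl.
    unfold c2, c3, X, Y; field; lra.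
  - match goal with |- is_RInt _ _ _ ?I =>
      replace I with (2 * PI * F s
        + PI * (c2 * X ^ 2 + c3 * ((B1 + D1) ^ 2 + (B2 + D2) ^ 2))
        + PI * (c2 * Y ^ 2 + c3 * ((D2 - B2) ^ 2 + (B1 - D1) ^ 2)))
    end.
    + apply is_RInt_trigonometric_quadratic.
    + assert (HXY : X ^ 2 + Y ^ 2 = s ^ 2 * (B1 ^ 2 + B2 ^ 2 + D1 ^ 2 + D2 ^ 2)
         + 2 * fst ((Cconj (v1, v2) * Cconj (v1, v2) * (B1, B2) * (D1, D2))%C)).
      { unfold X, Y; rewrite Hs2; simpl; ring. }
      transitivity (2 * PI * F s + PI * (c2 * (X ^ 2 + Y ^ 2)
         + 2 * c3 * (B1 ^ 2 + B2 ^ 2 + D1 ^ 2 + D2 ^ 2))); [ring|].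
      rewrite HXY; clear HXY; unfold c2, c3; simpl; field; lra.
Qed.

Lemma circle_energy_expansion F v eta :
  convex_profile F ->
  v <> RtoC 0 -> locally (Cmod v) (fun t => ex_derive F t) ->
  ex_derive (Derive F) (Cmod v) -> 0 < eta ->
  exists delta, 0 < delta /\ forall B D, Cmod B + Cmod D <= delta ->
    Rabs (circle_energy F v B D
          - 2 * PI * (F (Cmod v) + mean_quadratic F v B D))
      <= 2 * PI * (eta * (Cmod B + Cmod D) ^ 2).
Proof.
  intros HF Hv H1 H2 Heta.
  destruct (radial_taylor_bound F v eta Hv H1 H2 Heta) as (d & Hd & HT).
  exists d; split; auto; intros B D HBD.
  pose proof (is_RInt_radial_taylor F v B D Hv) as HI.
  pose proof (is_RInt_unique _ _ _ _ HI) as HU.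
  rewrite <- HU; unfold circle_energy.
  pose proof (ex_RInt_circle_energy F v B D 0 (2 * PI) HF) as HE.
  match goal with |- Rabs (?a - ?b) <= _ => change (a - b) with (minus a b) end.
  assert (HE2 : ex_RInt (fun t => radial_taylor F v (circle_affine (RtoC 0) B D t))
     0 (2 * PI)) by (eexists; apply HI).
  rewrite <- (@RInt_minus R_CompleteNormedModule) by auto.
  pose proof PI_RGT_0.
  eapply Rle_trans.
  - apply (abs_RInt_le_const _ _ _ (eta * (Cmod B + Cmod D) ^ 2)).
    + lra.
    + apply (@ex_RInt_minus R_NormedModule); auto.
    + intros t _; unfold minus, plus, opp; simpl.
      pose proof (Cmod_circle_affine_le (RtoC 0) B D t) as Hle.
      rewrite Cmod_0, Rplus_0_l in Hle.
      replace (circle_affine v B D t) with (v + circle_affine (RtoC 0) B D t)%C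
        by (unfold circle_affine; ring).
      eapply Rle_trans; [apply HT; lra|].
      apply Rmult_le_compat_l; [lra|].
      apply (pow_incr _ _ 2); split; [apply Cmod_ge_0|lra].
  - right; ring.
Qed.

(** * The minimizing coefficient *)

(** The minimum point in [D] of the averaged quadratic form, for fixed [B].  At
    [B = sigma] it equals [tau - operatorF F v sigma tau]. *)
Definition optimal_coefficient (F : R -> R) (v B : C) : C :=
  (RtoC (- ((Lambda F (Cmod v) - 1) / (Lambda F (Cmod v) + 1)))
   * (v / Cconj v) * Cconj B)%C.

(** The coefficient in front of [|d|^2] is positive, since it equals
    [(Lambda + 1) F' / (4 |v|)] at [|v|]. *)
Lemma mean_quadratic_complete_square F v B d :
  v <> RtoC 0 -> 0 < Derive F (Cmod v) -> 0 < Lambda F (Cmod v) ->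
  mean_quadratic F v B (optimal_coefficient F v B + d)%C
  = mean_quadratic F v B (optimal_coefficient F v B)
    + (Derive_n F 2 (Cmod v) + Derive F (Cmod v) / Cmod v) / 4 * Cmod d ^ 2.
Proof.
  intros Hv Hk1 HL; apply Cmod_gt_0 in Hv.
  assert (Hvv : (v / Cconj v)%C = (v * v * RtoC (/ Cmod v ^ 2))%C).
  { assert (Hc : Cconj v <> RtoC 0).
    { apply Cmod_gt_0; rewrite Cmod_conj; auto. }
    assert (Hm : (RtoC (/ Cmod v ^ 2) * (v * Cconj v))%C = RtoC 1).
    { rewrite <- Cmod2_conj.
      rewrite <- RtoC_mult; f_equal; field; lra. }
    replace (v / Cconj v)%C
      with (v / Cconj v * (RtoC (/ Cmod v ^ 2) * (v * Cconj v)))%C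
      by (rewrite Hm; ring).
    field; auto. }
  unfold optimal_coefficient; rewrite Hvv; unfold mean_quadratic; cbv zeta.
  set (s := Cmod v) in *.
  set (L := Lambda F s) in *.
  assert (Hk2 : Derive_n F 2 s = L * Derive F s / s)
    by (unfold L, Lambda; field; lra).
  rewrite Hk2; set (k1 := Derive F s) in *.
  assert (Hs2 : s ^ 2 = Re v ^ 2 + Im v ^ 2) by apply Cmod2_alt.
  rewrite !Cmod2_alt; rewrite Hs2 in *.
  assert (0 < s ^ 2) by (apply pow_lt; auto).
  destruct v as [v1 v2], B as [B1 B2], d as [d1 d2].
  unfold Re, Im in *; simpl; simpl in *.
  field; repeat split; try lra.
Qed.

(** What the second-order expansion at modulus [s] needs; the two signs make the
    averaged quadratic form positive definite in [D]. *)
Definition regular_at (F : R -> R) (s : R) : Prop :=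
  locally s (fun t => ex_derive F t) /\ ex_derive (Derive F) s /\
  0 < Derive F s /\ 0 < Lambda F s.

Lemma optimal_coefficient_scal F v r B :
  optimal_coefficient F v (RtoC r * B)%C = (RtoC r * optimal_coefficient F v B)%C.
Proof.
  unfold optimal_coefficient.
  replace (Cconj (RtoC r * B)%C) with (RtoC r * Cconj B)%C; [ring|].
  destruct B; apply injective_projections; simpl; ring.
Qed.

(** On the circle of radius [r eps] the expansion gives the inequality for [r]
    small; convexity along rays carries it outwards. *)
Lemma circle_energy_growth F v sigma eps :
  convex_profile F -> v <> RtoC 0 -> regular_at F (Cmod v) -> 0 < eps ->
  exists delta, 0 < delta /\ forall r, 0 < r < delta ->
    forall D, r * eps <= Cmod (D - optimal_coefficient F v (RtoC r * sigma))%C ->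
    circle_energy F v (RtoC r * sigma)%C (optimal_coefficient F v (RtoC r * sigma)%C)
    < circle_energy F v (RtoC r * sigma)%C D.
Proof.
  intros HF Hv (H1 & H2 & Hk1 & HL) He.
  pose proof (proj1 (Cmod_gt_0 v) Hv) as Hs.
  set (m := (Derive_n F 2 (Cmod v) + Derive F (Cmod v) / Cmod v) / 4).
  assert (Hm : 0 < m).
  { unfold m.
    replace (Derive_n F 2 (Cmod v) + Derive F (Cmod v) / Cmod v)
      with ((Lambda F (Cmod v) + 1) * (Derive F (Cmod v) / Cmod v))
      by (unfold Lambda; field; lra).
    apply Rdiv_lt_0_compat; [|lra]; apply Rmult_lt_0_compat; [lra|].
    apply Rdiv_lt_0_compat; auto. }
  set (th := optimal_coefficient F v sigma).
  set (K := Cmod sigma + Cmod th + eps).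
  pose proof (Cmod_ge_0 sigma); pose proof (Cmod_ge_0 th).
  assert (HK : 0 < K) by (unfold K; lra).
  (* chosen so that the errors of the two expansions, per unit of angle, add up
     to at most half of the gain m (r eps)^2 *)
  set (eta := m * eps ^ 2 / (4 * K ^ 2)).
  assert (HK2 : 0 < K ^ 2) by (apply pow_lt; auto).
  assert (He2 : 0 < eps ^ 2) by (apply pow_lt; auto).
  assert (Heta : 0 < eta) by (apply Rdiv_lt_0_compat; nra).
  destruct (circle_energy_expansion F v eta HF Hv H1 H2 Heta) as (d & Hd & HE).
  exists (d / K); split; [apply Rdiv_lt_0_compat; auto|].
  intros r [Hr Hrd].
  assert (HrK : r * K <= d).
  { apply Rle_trans with (d / K * K); [|right; field; lra].
    apply Rmult_le_compat_r; lra. }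
  set (B := (RtoC r * sigma)%C).
  set (D0 := optimal_coefficient F v B).
  assert (HD0 : Cmod D0 = r * Cmod th).
  { unfold D0, B; rewrite optimal_coefficient_scal, Cmod_mult, Cmod_R.
    rewrite Rabs_right by lra; auto. }
  assert (HB : Cmod B = r * Cmod sigma).
  { unfold B; rewrite Cmod_mult, Cmod_R, Rabs_right by lra; auto. }
  pose proof PI_RGT_0 as HPI.
  assert (Hcircle : forall D, Cmod (D - D0)%C = r * eps ->
            circle_energy F v B D0 < circle_energy F v B D).
  { intros D HD.
    assert (HDn : Cmod D <= r * eps + r * Cmod th).
    { replace D with ((D - D0) + D0)%C by ring.
      eapply Rle_trans; [apply Cmod_triangle|]; lra. }
    assert (HrK2 : (r * K) ^ 2 = r ^ 2 * K ^ 2) by ring.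
    assert (Hb : forall D, Cmod B + Cmod D <= r * K ->
       Rabs (circle_energy F v B D - 2 * PI * (F (Cmod v) + mean_quadratic F v B D))
       <= 2 * PI * (m * eps ^ 2 / 4 * r ^ 2)).
    { intros D' HD'; eapply Rle_trans; [apply HE; lra|].
      apply Rmult_le_compat_l; [lra|].
      apply Rle_trans with (eta * (r * K) ^ 2).
      - apply Rmult_le_compat_l; [lra|].
        apply pow_incr; split; auto.
        pose proof (Cmod_ge_0 B); pose proof (Cmod_ge_0 D'); lra.
      - right; unfold eta; field; lra. }
    assert (Hb0 := Hb D0 ltac:(unfold K; nra)).
    assert (Hb1 := Hb D ltac:(unfold K; nra)).
    apply Rabs_le_between in Hb0; apply Rabs_le_between in Hb1.
    pose proof (mean_quadratic_complete_square F v B (D - D0)%C Hv Hk1 HL) as Hq.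
    fold D0 m in Hq; rewrite HD in Hq.
    replace (D0 + (D - D0))%C with D in Hq by ring.
    rewrite Hq in Hb1.
    assert (0 < 2 * PI * (m * (r * eps) ^ 2 / 2)).
    { apply Rmult_lt_0_compat; [lra|].
      assert (0 < (r * eps) ^ 2) by (apply pow_lt, Rmult_lt_0_compat; auto).
      nra. }
    nra. }
  intros D HD.
  destruct (Req_dec (Cmod (D - D0)%C) (r * eps)) as [Heq|Hne]; auto.
  (* outside the circle, compare on the segment from D0 to D *)
  assert (Hre : 0 < r * eps) by (apply Rmult_lt_0_compat; auto).
  assert (HDD : r * eps < Cmod (D - D0)%C).
  { destruct HD as [HD|HD]; auto; exfalso; auto. }
  set (l := r * eps / Cmod (D - D0)%C).
  assert (Hl : 0 < l < 1).
  { unfold l; split; [apply Rdiv_lt_0_compat; lra|].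
    apply Rmult_lt_reg_r with (Cmod (D - D0)%C); [lra|]; field_simplify; lra. }
  assert (HDne : D <> D0).
  { intros E; rewrite E in HDD.
    replace (D0 - D0)%C with (RtoC 0) in HDD by ring.
    rewrite Cmod_0 in HDD; lra. }
  pose proof (circle_energy_strictly_convex F v B D D0 l HF HDne Hl) as Hcv.
  assert (Hon := Hcircle (RtoC l * D + RtoC (1 - l) * D0)%C).
  replace (RtoC l * D + RtoC (1 - l) * D0 - D0)%C with (RtoC l * (D - D0))%C in Hon
    by (rewrite RtoC_minus; ring).
  rewrite Cmod_mult, Cmod_R, Rabs_right in Hon by lra.
  specialize (Hon ltac:(unfold l; field; lra)).
  nra.
Qed.

(** * Existence, uniqueness and localization of the minimum point *)

Lemma list_minimizer {T : Type} (g : T -> R) (l : list T) :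
  l <> nil -> exists x, In x l /\ forall y, In y l -> g x <= g y.
Proof.
  induction l as [|a [|b l] IH]; intros Hl; [tauto| |].
  - exists a; split; [left; auto|]; intros y [->|[]]; lra.
  - destruct IH as (x & Hx & Hm); [discriminate|].
    destruct (Rle_dec (g a) (g x)) as [Hle|Hle].
    + exists a; split; [left; auto|].
      intros y [->|Hy]; [lra|]; specialize (Hm y Hy); lra.
    + exists x; split; [right; auto|].
      intros y [->|Hy]; [lra|auto].
Qed.

(** The closed square with centre [c] and half side [K]. *)
Definition in_square (c : C) (K : R) (p : C) : Prop :=
  Rabs (Re p - Re c) <= K /\ Rabs (Im p - Im c) <= K.

Lemma continuous_square_minimum (Phi : C -> R) (c : C) (K : R) :
  0 <= K -> (forall p, continuous Phi p) ->
  exists p, in_square c K p /\ forall q, in_square c K q -> Phi p <= Phi q.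
Proof.
  intros HK Hc; apply NNPP; intros Hno.
  (* without a minimum, each point of the square has a neighborhood on which
     some fixed point of the square does better *)
  assert (Hloc : forall t : Compactness.Tn 2 R, exists w : posreal * C,
    in_square c K (fst t, fst (snd t)) ->
    in_square c K (snd w) /\
    forall x : C, Rabs (Re x - fst t) < fst w -> Rabs (Im x - fst (snd t)) < fst w ->
      Phi (snd w) < Phi x).
  { intros (t1 & t2 & []); simpl.
    destruct (classic (in_square c K (t1, t2))) as [Hin|Hout].
    2: { exists (mkposreal 1 Rlt_0_1, RtoC 0); tauto. }
    destruct (classic (exists q, in_square c K q /\ Phi q < Phi (t1, t2)))
      as [(q & Hq & Hlt)|Hn].
    - destruct (Hc (t1, t2) _ (open_gt (Phi q) _ Hlt)) as [d Hd].
      exists (d, q); simpl; intros _; split; auto.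
      intros x Hx1 Hx2; apply Hd; split; auto.
    - exfalso; apply Hno; exists (t1, t2); split; auto.
      intros q Hq; apply Rnot_lt_le; intros Hlt; apply Hn; eauto. }
  apply choice in Hloc; destruct Hloc as [w Hw].
  apply (compactness_list 2 (Re c - K, (Im c - K, tt)) (Re c + K, (Im c + K, tt))
           (fun t => fst (w t))).
  intros (l & Hl).
  assert (Hbox : forall x1 x2, in_square c K (x1, x2) ->
     exists t, In t l /\ in_square c K (fst t, fst (snd t)) /\
       Rabs (x1 - fst t) < fst (w t) /\ Rabs (x2 - fst (snd t)) < fst (w t)).
  { intros x1 x2 [Hx1 Hx2]; unfold Re, Im in *; simpl in *.
    apply Rabs_le_between in Hx1; apply Rabs_le_between in Hx2.
    destruct (Hl (x1, (x2, tt))) as (t & Ht & Hb & Hcl).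
    - simpl; repeat split; lra.
    - exists t; destruct t as (t1 & t2 & []); simpl in *.
      split; auto; split; [|tauto].
      unfold in_square, Re, Im; simpl; split; apply Rabs_le; lra. }
  assert (Hcc : in_square c K (Re c, Im c)).
  { unfold in_square; simpl; rewrite !Rminus_diag, Rabs_R0; auto. }
  set (P := fun t : Compactness.Tn 2 R =>
    if excluded_middle_informative (in_square c K (fst t, fst (snd t)))
    then true else false).
  assert (HP : forall t, In t (filter P l) <->
     In t l /\ in_square c K (fst t, fst (snd t))).
  { intros t; rewrite filter_In; unfold P.
    destruct (excluded_middle_informative _); intuition discriminate. }
  destruct (list_minimizer (fun t => Phi (snd (w t))) (filter P l)) as (t & Ht & Hm).
  { destruct (Hbox _ _ Hcc) as (t & H1 & H2 & _).
    intros E; assert (Hf : In t (filter P l)) by (apply HP; auto).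
    rewrite E in Hf; destruct Hf. }
  apply HP in Ht; destruct Ht as [_ Ht].
  destruct (Hw t Ht) as [Hwt _].
  assert (Hwt' : in_square c K (Re (snd (w t)), Im (snd (w t)))) by exact Hwt.
  destruct (Hbox _ _ Hwt') as (u & Hu & Hus & Hu1 & Hu2).
  destruct (Hw u Hus) as [_ Hbetter].
  specialize (Hbetter (snd (w t)) Hu1 Hu2).
  specialize (Hm u ltac:(apply HP; auto)).
  simpl in Hm; lra.
Qed.

Lemma continuous_circle_energy_coefficient F A B D :
  convex_profile F -> continuous (circle_energy F A B) D.
Proof.
  intros HF.
  apply filterlim_locally; intros eps.
  set (L := 2 * PI * F (Cmod A + Cmod B + (Cmod D + 1) + 1)).
  pose proof PI_RGT_0 as HPI.
  assert (HL : 0 < L).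
  { apply Rmult_lt_0_compat; [lra|]; apply convex_profile_pos; auto.
    pose proof (Cmod_ge_0 A); pose proof (Cmod_ge_0 B); pose proof (Cmod_ge_0 D).
    lra. }
  set (e := Rmin 1 (eps / L)).
  assert (He : 0 < e).
  { apply Rmin_glb_lt; [lra|]; apply Rdiv_lt_0_compat; auto; apply cond_pos. }
  assert (Hr2 : 0 < sqrt 2) by (apply sqrt_lt_R0; lra).
  assert (Hd : 0 < e / sqrt 2) by (apply Rdiv_lt_0_compat; auto).
  exists (mkposreal _ Hd); intros D' HD'.
  apply C_NormedModule_mixin_compat2 in HD'; simpl in HD'.
  replace (sqrt 2 * (e / sqrt 2)) with e in HD' by (field; lra).
  change (Cmod (D' - D)%C < e) in HD'.
  assert (He1 : e <= 1) by apply Rmin_l.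
  assert (He2 : e <= eps / L) by apply Rmin_r.
  change (Rabs (circle_energy F A B D' - circle_energy F A B D) < eps).
  eapply Rle_lt_trans.
  - apply (circle_energy_lipschitz F A B D' D (Cmod D + 1)); auto; [|lra].
    replace D' with ((D' - D) + D)%C by ring.
    eapply Rle_trans; [apply Cmod_triangle|]; lra.
  - fold L; apply Rlt_le_trans with (L * (eps / L)); [|right; field; lra].
    apply Rmult_lt_compat_l; lra.
Qed.

Lemma circle_energy_unique_minimum F A B D0 rho :
  convex_profile F -> 0 < rho ->
  (forall D, rho <= Cmod (D - D0)%C ->
     circle_energy F A B D0 < circle_energy F A B D) ->
  exists D, Cmod (D - D0)%C < rho /\
    forall D', D' <> D -> circle_energy F A B D < circle_energy F A B D'.
Proof.
  intros HF Hrho Hout.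
  destruct (continuous_square_minimum (circle_energy F A B) D0 rho) as (D & _ & HD).
  { lra. }
  { intros; apply continuous_circle_energy_coefficient; auto. }
  assert (Hc : in_square D0 rho D0).
  { unfold in_square; rewrite !Rminus_diag, Rabs_R0; lra. }
  assert (Hmin : forall D', circle_energy F A B D <= circle_energy F A B D').
  { intros D'.
    destruct (Rle_dec rho (Cmod (D' - D0)%C)) as [Hle|Hlt].
    - specialize (HD _ Hc); specialize (Hout _ Hle); lra.
    - apply HD.
      pose proof (Rmax_Cmod (D' - D0)%C) as Hmax.
      pose proof (Rmax_l (Rabs (fst (D' - D0)%C)) (Rabs (snd (D' - D0)%C))) as Hl.
      pose proof (Rmax_r (Rabs (fst (D' - D0)%C)) (Rabs (snd (D' - D0)%C))) as Hr.
      split; [change (Rabs (fst (D' - D0)%C) <= rho)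
             |change (Rabs (snd (D' - D0)%C) <= rho)]; lra. }
  exists D; split.
  - apply Rnot_le_lt; intros Hle.
    specialize (Hout _ Hle); specialize (Hmin D0); lra.
  - intros D' HD'.
    pose proof (circle_energy_strictly_convex F A B D' D (/2) HF HD' ltac:(lra)) as Hs.
    specialize (Hmin (RtoC (/ 2) * D' + RtoC (1 - / 2) * D)%C).
    lra.
Qed.

(** * Asymptotics of the mean of an affine map *)

Lemma energy_affine_map F f z sigma tau r a b :
  convex_profile F ->
  energy F (affine_map f z sigma tau) r z (a, b)
  = r * (circle_energy F (f z - a)%C (RtoC r * sigma)%C (RtoC r * tau)%C
         + circle_energy F (f z) (RtoC r * sigma)%C (RtoC r * (tau - b))%C).
Proof.
  intros HF; unfold energy, circle_integral, circle_energy; simpl fst; simpl snd.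
  set (g1 := fun t => F (Cmod (circle_affine (f z - a)%C (RtoC r * sigma)%C
                                (RtoC r * tau)%C t))).
  set (g2 := fun t => F (Cmod (circle_affine (f z) (RtoC r * sigma)%C
                                (RtoC r * (tau - b))%C t))).
  assert (H1 : ex_RInt g1 0 (2 * PI)) by (apply ex_RInt_circle_energy; auto).
  assert (H2 : ex_RInt g2 0 (2 * PI)) by (apply ex_RInt_circle_energy; auto).
  change (r * (RInt g1 0 (2 * PI) + RInt g2 0 (2 * PI)))
    with (scal r (plus (RInt g1 0 (2 * PI)) (RInt g2 0 (2 * PI)))).
  rewrite <- (@RInt_plus R_CompleteNormedModule) by auto.
  rewrite <- (@RInt_scal R_CompleteNormedModule)
    by (apply (@ex_RInt_plus R_NormedModule); auto).
  apply RInt_ext; intros t _.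
  unfold g1, g2, scal, plus; simpl; unfold mult; simpl.
  rewrite Rmult_comm; f_equal; f_equal; f_equal; f_equal;
    unfold affine_map, circle_affine;
    destruct (f z), sigma, tau, z; try destruct a; try destruct b;
    apply injective_projections; simpl; ring.
Qed.

(** The operator is the first-order coefficient in [r] of the mean of an affine
    map. *)
Lemma mean_affine_map_expansion F f z sigma tau eps :
  convex_profile F -> f z <> RtoC 0 -> regular_at F (Cmod (f z)) -> 0 < eps ->
  at_right 0 (fun r =>
    Cmod (mean F (affine_map f z sigma tau) r z - f z
          - RtoC r * operatorF F (f z) sigma tau)%C <= eps * r).
Proof.
  intros HF Hv Hreg He.
  destruct (circle_energy_growth F (f z) sigma eps HF Hv Hreg He)
    as (delta & Hdelta & Hg).
  exists (mkposreal delta Hdelta); intros r Hball Hr.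
  assert (Hrd : r < delta).
  { change (Rabs (r - 0) < delta) in Hball.
    rewrite Rminus_0_r, Rabs_right in Hball; lra. }
  specialize (Hg r (conj Hr Hrd)).
  set (B := (RtoC r * sigma)%C) in *.
  set (D0 := optimal_coefficient F (f z) B) in *.
  destruct (circle_energy_unique_minimum F (f z) B D0 (r * eps) HF
    ltac:(apply Rmult_lt_0_compat; auto) Hg) as (D & HD & Hmin).
  assert (Hrr : (RtoC r * RtoC (/ r))%C = RtoC 1).
  { rewrite <- RtoC_mult; f_equal; field; lra. }
  set (b := (tau - RtoC (/ r) * D)%C).
  assert (Hb : (RtoC r * (tau - b))%C = D).
  { unfold b; replace (RtoC r * (tau - (tau - RtoC (/ r) * D)))%C
      with (RtoC r * RtoC (/ r) * D)%C by ring.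
    rewrite Hrr; ring. }
  assert (Huniq : unique (is_minimum_point (energy F (affine_map f z sigma tau) r z))
                    (f z, b)).
  { assert (Hstrict : forall q, (f z, b) <> q ->
       energy F (affine_map f z sigma tau) r z (f z, b)
       < energy F (affine_map f z sigma tau) r z q).
    { intros [a' b'] Hq; rewrite !energy_affine_map by auto; fold B.
      rewrite Hb; apply Rmult_lt_compat_l; auto.
      replace (f z - f z)%C with (RtoC 0) by ring.
      destruct (classic (a' = f z)) as [Ha|Ha].
      - subst a'; replace (f z - f z)%C with (RtoC 0) by ring.
        apply Rplus_lt_compat_l, Hmin; intros E; apply Hq; f_equal.
        unfold b; rewrite <- E.
        replace (RtoC (/ r) * (RtoC r * (tau - b')))%C
          with (RtoC r * RtoC (/ r) * (tau - b'))%C by ring.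
        rewrite Hrr; ring.
      - assert (Ha0 : (f z - a')%C <> RtoC 0).
        { intros E; apply Ha; replace a' with (f z - (f z - a'))%C by ring.
          rewrite E; ring. }
        pose proof (circle_energy_centre F _ B (RtoC r * tau)%C HF Ha0).
        destruct (classic ((RtoC r * (tau - b'))%C = D)) as [E|E].
        + rewrite E; lra.
        + specialize (Hmin _ E); lra. }
    split.
    - intros q; destruct (classic ((f z, b) = q)) as [<-|Hq]; [lra|].
      left; auto.
    - intros q Hq; apply NNPP; intros Hne.
      specialize (Hq (f z, b)); specialize (Hstrict q Hne); lra. }
  assert (Hpair : mean_pair F (affine_map f z sigma tau) r z = (f z, b)).
  { pose proof (epsilon_spec (inhabits (RtoC 0, RtoC 0)) _ (ex_intro _ _ Huniq)) as Hs.
    apply (proj2 Hs), Huniq. }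
  unfold mean; rewrite Hpair; simpl fst; simpl snd.
  replace (f z + RtoC r * b - f z - RtoC r * operatorF F (f z) sigma tau)%C
    with (- (D - D0))%C.
  - rewrite Cmod_opp; lra.
  - rewrite <- Hb; unfold D0, B; rewrite optimal_coefficient_scal.
    unfold optimal_coefficient, operatorF; rewrite RtoC_opp; ring.
Qed.

(** [Derive F s] is nonnegative by monotonicity and nonzero because division by
    zero returns zero, which would contradict the lower bound on [Lambda F s]. *)
Lemma regular_at_profile F Lambda_min Lambda_max s :
  convex_profile F -> C1_closed_half_line F -> C2_open_half_line F ->
  0 < Lambda_min -> (forall s, 0 < s -> Lambda_min <= Lambda F s <= Lambda_max) ->
  0 < s -> regular_at F s.
Proof.
  intros HF [F1 HC1] HC2 HL Hb Hs.
  (* a derivative relative to the half line is an ordinary one at t > 0 *)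
  assert (Hder : forall t, 0 < t -> is_derive F t (F1 t)).
  { intros t Ht; destruct (HC1 t ltac:(lra)) as [HD _].
    apply is_derive_Reals; intros e He.
    destruct (HD e He) as (d & Hd & Hlim).
    assert (Hm : 0 < Rmin d t) by (apply Rmin_glb_lt; auto).
    exists (mkposreal _ Hm); intros h Hh Hhd; simpl in Hhd.
    pose proof (Rmin_l d t); pose proof (Rmin_r d t).
    pose proof (Rle_abs (- h)) as Hneg; rewrite Rabs_Ropp in Hneg.
    specialize (Hlim (t + h)); simpl in Hlim; unfold R_dist in Hlim.
    replace (t + h - t) with h in Hlim by ring.
    apply Hlim; repeat split; try lra. }
  destruct (Hb s Hs) as [HLs _].
  assert (Hne : Derive F s <> 0).
  { intros E; unfold Lambda, Rdiv in HLs; rewrite E, Rinv_0 in HLs; lra. }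
  assert (Hge : 0 <= Derive F s).
  { rewrite (is_derive_unique _ _ _ (Hder s Hs)).
    apply Rnot_lt_le; intros Hlt.
    pose proof (proj1 (is_derive_Reals _ _ _) (Hder s Hs)) as Hlim.
    destruct (Hlim (- F1 s) ltac:(lra)) as [d Hd].
    pose proof (cond_pos d).
    specialize (Hd (d / 2) ltac:(lra)).
    rewrite Rabs_right in Hd by lra.
    specialize (Hd ltac:(lra)).
    apply Rabs_def2 in Hd.
    pose proof (convex_profile_increasing F s (s + d / 2) HF ltac:(lra)).
    assert (0 < (F (s + d / 2) - F s) / (d / 2)) by (apply Rdiv_lt_0_compat; lra).
    lra. }
  repeat split; try lra.
  - exists (mkposreal s Hs); intros t Ht.
    change (Rabs (t - s) < s) in Ht.
    apply Rabs_def2 in Ht.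
    eexists; apply Hder; lra.
  - apply (proj1 (HC2 s Hs)).
Qed.

Theorem theorem1p5
  (F : R -> R)
  (hF_nonneg : forall s, 0 <= s -> 0 <= F s)
  (hF_C1 : C1_closed_half_line F)
  (hF_C2 : C2_open_half_line F)
  (hF_convex : strictly_convex_half_line F)
  (hF0 : F 0 = 0)
  (c alpha : R) (hc : 0 < c) (halpha : 0 < alpha)
  (hF_asymp : is_domin (at_right 0) (fun s => Rpower s alpha)
                (fun s => Derive F s - c * Rpower s alpha))
  (Lambda_min Lambda_max : R)
  (hLambda : 0 < Lambda_min <= Lambda_max)
  (hLambda_bounds : forall s, 0 < s -> Lambda_min <= Lambda F s <= Lambda_max)
  (Omega : C -> Prop) (hOmega : planar_domain Omega)
  (f : C -> C) (hf : forall z, Omega z -> continuous f z) :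
  contact_solution F Omega f <-> CAMVP F Omega f.
Proof.
  assert (HF : convex_profile F) by (repeat split; auto).
  assert (Hexp : forall z xi sigma tau eps, f z <> RtoC 0 -> unit_circle xi ->
    0 < eps -> at_right 0 (fun r =>
      Rabs (Re (Cconj xi * (mean F (affine_map f z sigma tau) r z - f z))%C
            - r * Re (Cconj xi * operatorF F (f z) sigma tau)%C) <= eps * r)).
  { intros z xi sigma tau eps Hz Hxi Heps.
    assert (Hreg : regular_at F (Cmod (f z))).
    { apply (regular_at_profile F Lambda_min Lambda_max); auto; [lra|].
      apply Cmod_gt_0; auto. }
    generalize (mean_affine_map_expansion F f z sigma tau eps HF Hz Hreg Heps).
    apply filter_imp; intros r Hr.
    match goal with |- Rabs ?x <= _ => replace x with
      (Re (Cconj xi * (mean F (affine_map f z sigma tau) r z - f z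
          - RtoC r * operatorF F (f z) sigma tau))%C) end.
    - eapply Rle_trans; [apply re_le_Cmod|].
      rewrite Cmod_mult, Cmod_conj, Hxi; lra.
    - unfold Re; simpl; ring. }
  split; intros H z Hz Hfz xi Hxi sigma tau Hjet.
  - specialize (H z Hz Hfz xi Hxi sigma tau Hjet).
    exists (fun r => Re (Cconj xi * (mean F (affine_map f z sigma tau) r z - f z))%C
       - r * Re (Cconj xi * operatorF F (f z) sigma tau)%C).
    split.
    + intros eps.
      assert (Hpos : at_right 0 (fun r => 0 < r)).
      { exists (mkposreal 1 Rlt_0_1); auto. }
      generalize (filter_and _ _ Hpos
        (Hexp z xi sigma tau eps Hfz Hxi (cond_pos eps))).
      apply filter_imp; intros r [Hr He].
      unfold norm; simpl; unfold abs; simpl.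
      rewrite (Rabs_right r) by lra; auto.
    + exists (mkposreal 1 Rlt_0_1); intros r _ Hr.
      assert (0 <= r * Re (Cconj xi * operatorF F (f z) sigma tau)%C)
        by (apply Rmult_le_pos; lra).
      lra.
  - destruct (H z Hz Hfz xi Hxi sigma tau Hjet) as (e & He & Hlow).
    set (x := Re (Cconj xi * operatorF F (f z) sigma tau)%C).
    apply Rnot_lt_le; intros Hneg.
    assert (Heps : 0 < - x / 4) by lra.
    assert (Hpos : at_right 0 (fun r => 0 < r)).
    { exists (mkposreal 1 Rlt_0_1); auto. }
    destruct (filter_ex _ (filter_and _ _ Hpos (filter_and _ _ Hlow (filter_and _ _
      (He (mkposreal _ Heps)) (Hexp z xi sigma tau _ Hfz Hxi Heps)))))
      as (r & Hr & Hlo & Hdom & Hx).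
    unfold norm in Hdom; simpl in Hdom; unfold abs in Hdom; simpl in Hdom.
    rewrite (Rabs_right r) in Hdom by lra.
    fold x in Hx.
    apply Rabs_le_between in Hdom; apply Rabs_le_between in Hx.
    nra.
Qed.
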